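(* Let $M$ be a semiumbilical surface immersed in $\mathbb R^4$, with first and second fundamental forms $g$ and $\alpha$. Let $c$ be the (unique) section of $NM$ that satisfies $c\cdot\alpha=g$, and define $f:M\to\mathbb R^4$ by $f(p)=p+c_p$. If $f$ is an immersion, then $f(M)$ is an immersed flat surface (called the evolute of $M$). If, in addition, $M$ is flat, then $f(M)$ is semiumbilical.
   Context: $M$ is a smooth 2-dimensional surface immersed in $\mathbb R^4$; since everything is local it may be regarded as embedded. $T_pM$ and $N_pM=(T_pM)^\bot$ are regarded as vector subspaces of $\mathbb R^4$; $\cdot$ is the standard inner product; $NM$ is the normal bundle, whose sections are regarded as $\mathbb R^4$-valued maps. $D$ is the ordinary directional derivative; $\nabla^\top_XY=(D_XY)^\top$ and $\alpha(X,Y)=(D_XY)^\bot$ are its tangential and normal components for tangent fields. A surface is flat if the curvature of $\nabla^\top$ is zero everywhere. The curvature ellipse at $p$ is $\{\alpha_p(t,t)/(t\cdot t): t\in T_pM\setminus\{0\}\}\subset N_pM$. A point $p$ is semiumbilic if its curvature ellipse lies in an affine line (a segment or a point), and a point of inflection if it lies in an affine line through the origin of $N_pM$ (umbilic points, where the ellipse is a single point, count as inflection points). A surface is called semiumbilical if all its points are semiumbilic and none is a point of inflection; i.e. at each point the curvature ellipse is a nondegenerate segment not collinear with the origin. (Equivalently, semiumbilicity of all points means the normal bundle is flat.) On a semiumbilical surface in $\mathbb R^4$ there is a unique section $c$ of $NM$ with $c\cdot\alpha=g$, i.e. $c\cdot\alpha(X,Y)=X\cdot Y$ for all tangent $X,Y$;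 if $(t_1,t_2)$ is a local orthonormal tangent frame with $\alpha(t_1,t_2)=0$, $B=\frac12(\alpha(t_1,t_1)-\alpha(t_2,t_2))$, $H=\frac12(\alpha(t_1,t_1)+\alpha(t_2,t_2))$ and $J$ is a rotation by a right angle in the normal planes, then $c=JB/(H\cdot JB)$. When $f$ is an immersion, $f(M)$ is regarded as a surface immersed in $\mathbb R^4$ via $f$. *)

(* Defs.v *)
From HB Require Import structures.
From mathcomp Require Import all_boot all_order all_algebra.
From mathcomp Require Import all_classical all_reals topology normedtype derive.
Set Implicit Arguments.
Unset Strict Implicit.
Unset Printing Implicit Defensive.
Import Order.TTheory GRing.Theory Num.Theory.
Import numFieldNormedType.Exports.
Local Open Scope classical_set_scope.
Local Open Scope ring_scope.

Definition iterD (R : realType) (V : normedModType R)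
    (vs : seq 'rV[R]_2) (F : 'rV[R]_2 -> V) : 'rV[R]_2 -> V :=
  foldr (fun v G u => 'D_v G u) F vs.

(* C^oo on U.  For open U, the values of F outside U are irrelevant. *)
Definition smooth_on (R : realType) (V : normedModType R)
    (U : set 'rV[R]_2) (F : 'rV[R]_2 -> V) : Prop :=
  forall (vs : seq 'rV[R]_2) (u : 'rV[R]_2),
    U u -> differentiable (iterD vs F) u.

(* Smooth 2-manifolds.  A chart i is given by its parametrization par i, of
   which only the restriction to dom i matters, and a left inverse crd i of
   that restriction. *)
Record surface (R : realType) := Surface {
  pts :> topologicalType;
  chart : Type;
  dom : chart -> set 'rV[R]_2;
  par : chart -> 'rV[R]_2 -> pts;
  crd : chart -> pts -> 'rV[R]_2;
  pts_hausdorff : hausdorff_space pts;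
  pts_second_countable : @second_countable pts;
  dom_open : forall i, open (dom i);
  parK : forall i u, dom i u -> crd i (par i u) = u;
  par_continuous : forall i u, dom i u -> {for u, continuous (par i)};
  par_open : forall i (V : set 'rV[R]_2),
    open V -> V `<=` dom i -> open (par i @` V);
  par_cover : forall p : pts, exists i, exists2 u, dom i u & par i u = p;
  par_transition : forall i j,
    smooth_on (dom i `&` par i @^-1` (par j @` dom j)) (crd j \o par i)
}.

Definition dot (R : realType) (v w : 'rV[R]_4) : R := (v *m w^T) 0 0.

(* Geometry of a parametrized surface x in R^4.  A vector field on the surface
   is given either by its components X : 'rV_2 -> 'rV_2, or as an R^4-valued
   map; push x X is the R^4-valued map with components X. *)
Section Parametrized.
Variables (R : realType) (x : 'rV[R]_2 -> 'rV[R]_4).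
Implicit Types (X Y : 'rV[R]_2 -> 'rV[R]_2) (Z : 'rV[R]_2 -> 'rV[R]_4).
Implicit Types (u a b : 'rV[R]_2).

(* The tangent and normal planes are the row spaces of these matrices. *)
Definition tangent_space u : 'M[R]_4 := <<'J x u>>%MS.
Definition normal_space u : 'M[R]_4 := kermx ('J x u)^T.

Definition tan_part u (w : 'rV[R]_4) : 'rV[R]_4 :=
  w *m proj_mx (tangent_space u) (normal_space u).
Definition nor_part u (w : 'rV[R]_4) : 'rV[R]_4 :=
  w *m proj_mx (normal_space u) (tangent_space u).

Definition push X : 'rV[R]_2 -> 'rV[R]_4 := fun u => 'D_(X u) x u.

Definition nabla X Z : 'rV[R]_2 -> 'rV[R]_4 :=
  fun u => tan_part u ('D_(X u) Z u).

Definition lie_bracket X Y : 'rV[R]_2 -> 'rV[R]_2 :=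
  fun u => 'D_(X u) Y u - 'D_(Y u) X u.

Definition curvature X Y Z : 'rV[R]_2 -> 'rV[R]_4 := fun u =>
  nabla X (nabla Y Z) u - nabla Y (nabla X Z) u - nabla (lie_bracket X Y) Z u.

Definition alpha X Y : 'rV[R]_2 -> 'rV[R]_4 :=
  fun u => nor_part u ('D_(X u) (push Y) u).

(* The first and second fundamental forms on tangent vectors with components
   a and b; alpha is tensorial, so that a and b may be extended to fields with
   constant components. *)
Definition first_form u a b : R := dot ('D_a x u) ('D_b x u).
Definition second_form u a b : 'rV[R]_4 := alpha (cst a) (cst b) u.

Definition curvature_ellipse u : set 'rV[R]_4 :=
  [set (first_form u a a)^-1 *: second_form u a a | a in [set a | a != 0]].

Definition affine_line (q d : 'rV[R]_4) : set 'rV[R]_4 :=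
  [set q + s *: d | s in [set: R]].

Definition semiumbilic_at u : Prop := exists q d : 'rV[R]_4,
  [/\ (q <= normal_space u)%MS, (d <= normal_space u)%MS, d != 0 &
      curvature_ellipse u `<=` affine_line q d].

Definition inflection_at u : Prop := exists d : 'rV[R]_4,
  [/\ (d <= normal_space u)%MS, d != 0 &
      curvature_ellipse u `<=` affine_line 0 d].

End Parametrized.

Section Immersed.
Variables (R : realType) (M : surface R).
Implicit Types phi c : M -> 'rV[R]_4.

Definition immersion phi : Prop := forall i : chart M,
  smooth_on (dom i) (phi \o par i) /\
  forall u, dom i u -> row_free ('J (phi \o par i) u).

Definition flat phi : Prop :=
  forall (i : chart M) (X Y : 'rV[R]_2 -> 'rV[R]_2) (Z : 'rV[R]_2 -> 'rV[R]_4),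
  smooth_on (dom i) X -> smooth_on (dom i) Y -> smooth_on (dom i) Z ->
  (forall u, dom i u -> (Z u <= tangent_space (phi \o par i) u)%MS) ->
  forall u, dom i u -> curvature (phi \o par i) X Y Z u = 0.

Definition semiumbilical phi : Prop := forall (i : chart M) u, dom i u ->
  semiumbilic_at (phi \o par i) u /\ ~ inflection_at (phi \o par i) u.

Definition normal_section phi c : Prop := forall i : chart M,
  smooth_on (dom i) (c \o par i) /\
  forall u, dom i u -> (c (par i u) <= normal_space (phi \o par i) u)%MS.

Definition dual_to_second_form phi c : Prop :=
  forall (i : chart M) u (a b : 'rV[R]_2), dom i u ->
  dot (c (par i u)) (second_form (phi \o par i) u a b) =
  first_form (phi \o par i) u a b.

End Immersed.

(* Main.v *)
(* Differentiating c . D_b x = 0 and using c . alpha = g shows that the evolute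
   y = x + c satisfies D_a y . D_b x = 0: the tangent planes of y are the normal
   planes of x, and conversely.  By the Gauss equation the curvature of y measures
   the commutators of the shape operators of x; the normal planes have dimension
   2 and the shape operator of c is the identity, so all of them commute and y is
   flat.
   For the second part, the form D_a y . D_b D_k x is, up to sign, the second
   fundamental form of y paired with the normal vectors D_k x, and it is totally
   symmetric in (a, b, k).  Flatness of x is the vanishing of the determinant which
   makes its two slices k = 0, 1 and the metric of y linearly dependent, so that
   some normal vector of y has the metric as second fundamental form, up to a
   factor: the curvature ellipse lies in a line.  If this line contained the origin,
   some normal vector D_e x of y would be orthogonal to the second fundamental
   form of y; since c is tangent to y, this would give D_e x . D_b x =
   c . alpha(e, b) = 0 for all b, hence e = 0. *)
Require Import Defs.
From HB Require Import structures.
From mathcomp Require Import all_boot all_order all_algebra.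
From mathcomp Require Import all_classical all_reals topology normedtype derive landau.
From mathcomp Require Import ring lra.
(* [topology] shadows [normal_space] and [ssrnat] shadows [iterD]. *)
Import Defs.
Import Order.TTheory GRing.Theory Num.Theory.
Import numFieldNormedType.Exports.
Local Open Scope classical_set_scope.
Local Open Scope ring_scope.

(** * Symmetry of second directional derivatives *)

Lemma is_derive_line (R : realType) (V W : normedModType R) (f : V -> W)
    (a p : V) (s : R) : differentiable f (s *: a + p) ->
  is_derive s 1 (fun r => f (r *: a + p)) ('D_a f (s *: a + p)).
Proof.
move=> df; have E : (fun h : R => h^-1 *:
    (((fun r => f (r *: a + p)) \o shift s) (h *: 1) - f (s *: a + p))) =
    (fun h => h^-1 *: ((f \o shift (s *: a + p)) (h *: a) - f (s *: a + p))).
  apply/funext => h /=.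
  have -> : h *: (1 : R) = h by exact: mulr1.
  by rewrite scalerDl addrA.
by split; rewrite /derivable /derive E //; apply: diff_derivable.
Qed.

Lemma differentiable_remainder {R : realType} {V W : normedModType R}
    {g : V -> W} {u : V} : differentiable g u -> forall e, 0 < e ->
  \forall h \near 0, `|g (h + u) - g u - 'd g u h| <= e * `|h|.
Proof.
move=> dg e e0; have /diff_locally E := dg.
have /eqaddoP/(_ e e0) := E.
apply: filterS => h /=; rewrite !fctE /=.
by rewrite opprD addrA.
Qed.

(** The mean value theorem along [a] turns the second difference into [t] times an increment of
    ['D_a f], which the differentiability of ['D_a f] at [u] expands up to [o(t)]. *)
Lemma second_difference {R : realType} {V : normedModType R} {f : V -> R}
    {u a : V} (b : V) :
  (\forall y \near u, differentiable f y) -> differentiable ('D_a f) u ->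
  forall e, 0 < e -> exists2 d, 0 < d & forall t, 0 < t -> t < d ->
  `|f (t *: a + (t *: b + u)) - f (t *: a + u) - f (t *: b + u) + f u
    - t ^+ 2 * 'D_b ('D_a f) u| <= e * t ^+ 2.
Proof.
move=> fd gd e e0; set g := 'D_a f.
(* The two remainders met below are bounded by multiples of [|a| + |b|] and of [|a|]; [M] dominates
   their sum, and the [1] keeps it positive. *)
set M := 2 * `|a| + `|b| + 1.
have M0 : 0 < M by rewrite /M ltr_wpDl// addr_ge0// mulr_ge0.
have eM : 0 < e / M by rewrite divr_gt0.
have /nbhs_ballP[r r0 rf] := fd.
have /nbhs_ballP[r' r'0 rg] := differentiable_remainder gd _ eM.
exists (Num.min r r' / M); first by rewrite divr_gt0// lt_min r0.
move=> t t0; rewrite ltr_pdivlMr// lt_min => /andP[tr tr'].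
have na := normr_ge0 a; have nb := normr_ge0 b.
have bnd s k : 0 <= s -> s <= t -> 0 <= k -> k <= t ->
    `|s *: a + k *: b| < t * M /\ `|s *: a + k *: b| <= t * (`|a| + `|b|).
  move=> s0 st k0 kt.
  have H : `|s *: a + k *: b| <= t * (`|a| + `|b|).
    rewrite mulrDr (le_trans (ler_normD _ _))// !normrZ !ger0_norm// lerD//.
      exact: ler_wpM2r.
    exact: ler_wpM2r.
  split=> //; apply: (le_lt_trans H); rewrite ltr_pM2l// /M.
  lra.
have dfl s k : 0 <= s -> s <= t -> 0 <= k -> k <= t ->
    differentiable f (s *: a + (k *: b + u)).
  move=> s0 st k0 kt; apply: rf; rewrite -ball_normE /=.
  rewrite addrA opprD addrCA subrr addr0 normrN.
  by have [/lt_trans ->] := bnd s k s0 st k0 kt.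
have rem s k : 0 <= s -> s <= t -> 0 <= k -> k <= t ->
    `|g (s *: a + k *: b + u) - g u - 'd g u (s *: a + k *: b)|
      <= e / M * `|s *: a + k *: b|.
  move=> s0 st k0 kt; apply: rg; rewrite -ball_normE /= sub0r normrN.
  by have [/lt_trans ->] := bnd s k s0 st k0 kt.
(* The term [0 *: b] gives both summands one shape, so that [dfl] and [rem] apply to each, with
   [k = t] and [k = 0]. *)
pose ph s := f (s *: a + (t *: b + u)) - f (s *: a + (0 *: b + u)).
have t0' := ltW t0.
have dph s : 0 <= s -> s <= t -> is_derive s 1 ph
    (g (s *: a + (t *: b + u)) - g (s *: a + (0 *: b + u))).
  move=> s0 st; apply: is_deriveB; apply: is_derive_line; exact: dfl.
have dph' : forall s, s \in `]0, t[%R -> is_derive s 1 ph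
    (g (s *: a + (t *: b + u)) - g (s *: a + (0 *: b + u))).
  by move=> s; rewrite in_itv /= => /andP[/ltW s0 /ltW st]; exact: dph.
have cph : {within `[0, t], continuous ph}.
  apply: derivable_within_continuous => s; rewrite in_itv /= => /andP[s0 st].
  by have [] := dph s s0 st.
have [x] := MVT t0 dph' cph.
rewrite in_itv /= => /andP[/ltW x0 /ltW xt].
rewrite /ph !scale0r !add0r subr0 => E.
have -> : f (t *: a + (t *: b + u)) - f (t *: a + u) - f (t *: b + u) + f u =
   f (t *: a + (t *: b + u)) - f (t *: a + u) - (f (t *: b + u) - f u).
  by ring.
rewrite {}E.
have H1 := rem x t x0 xt t0' (lexx t).
have H2 := rem x 0 x0 xt (lexx 0) t0'.
have [_ B1] := bnd x t x0 xt t0' (lexx t).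
have B2 : `|x *: a| <= t * `|a| by rewrite normrZ ger0_norm// ler_wpM2r.
move: H1 H2; rewrite -!addrA scale0r !add0r !addrA !addr0.
move=> H1 H2.
move: H1 H2; set g1 := g (_ + _ + u); set g2 := g (_ + u) => H1 H2.
rewrite deriveE//.
have alg (p q w y z s : R) :
    (p - q) * s - s ^+ 2 * z = (p - w - (y + s * z) - (q - w - y)) * s by ring.
have -> : (g1 - g2) * t - t ^+ 2 * 'd g u b =
    (g1 - g u - 'd g u (x *: a + t *: b) - (g2 - g u - 'd g u (x *: a))) * t.
  have -> : 'd g u (x *: a + t *: b) = 'd g u (x *: a) + t * 'd g u b.
    by rewrite linearD [X in _ + X]linearZ.
  exact: alg.
rewrite normrM (gtr0_norm t0) expr2 mulrA ler_wpM2r//.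
apply: (le_trans (ler_normB _ _)); apply: (le_trans (lerD H1 H2)).
rewrite -mulrDr -[e in leRHS](divfK (lt0r_neq0 M0)) -!mulrA.
apply: ler_wpM2l; first exact: ltW.
apply: ler_wpM2l; first by rewrite invr_ge0 ltW.
apply: (le_trans (lerD B1 B2)); rewrite -mulrDr mulrC ler_wpM2r//.
rewrite /M; lra.
Qed.

(** The second difference is symmetric in [a] and [b], and divided by [t ^+ 2] it approximates both
    mixed derivatives. *)
Lemma derive_comm (R : realType) (V : normedModType R) (f : V -> R) (u a b : V) :
  (\forall y \near u, differentiable f y) ->
  differentiable ('D_a f) u -> differentiable ('D_b f) u ->
  'D_a ('D_b f) u = 'D_b ('D_a f) u.
Proof.
move=> df da db; apply/eqP; rewrite -subr_eq0 -normr_le0.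
apply/ler_addgt0Pr => e e0; rewrite add0r.
have e2 : 0 < e / 2 by rewrite divr_gt0.
have [d1 d10 H1] := second_difference b df da _ e2.
have [d2 d20 H2] := second_difference a df db _ e2.
set t := Num.min d1 d2 / 2.
have t0 : 0 < t by rewrite divr_gt0// lt_min d10.
have /andP[t1 t2] : (t < d1) && (t < d2).
  rewrite -lt_min ltr_pdivrMr// ltr_pMr ?ltr1n// lt_min d10//.
have {}H1 := H1 t t0 t1; have {}H2 := H2 t t0 t2.
have tt : 0 < t ^+ 2 by rewrite exprn_gt0.
rewrite -(ler_pM2r tt) -[X in _ * X <= _](gtr0_norm tt) -normrM.
move: H1 H2; rewrite [t *: b + (t *: a + u)]addrCA.
set A := f _; set B := f _; set C := f _; set D := f u.
set p := 'D_b _ _; set q := 'D_a _ _ => H1 H2.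
have -> : (q - p) * t ^+ 2 =
  (A - B - C + D - t ^+ 2 * p) - (A - C - B + D - t ^+ 2 * q) by ring.
apply: (le_trans (ler_normB _ _)); apply: (le_trans (lerD H1 H2)).
by rewrite -mulrDl -splitr.
Qed.

(** * Calculus of maps into row vectors, entry by entry *)

Section RowCalculus.
Context {R : realType} {V : normedModType R}.

Lemma differentiable_entry {n} {F : V -> 'rV[R]_n} {u} j :
  differentiable F u -> differentiable (fun v => F v 0 j) u.
Proof.
move=> dF; apply: (@differentiable_comp _ _ _ _ F (fun M : 'rV[R]_n => M 0 j)).
  exact: dF.
exact: differentiable_coord.
Qed.

Lemma differentiable_row n (F : V -> 'rV[R]_n) u :
  (forall j, differentiable (fun v => F v 0 j) u) -> differentiable F u.
Proof.
move=> dF; have -> : F = \sum_j (fun v => F v 0 j *: delta_mx 0 j).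
  by apply/funext => v; rewrite fct_sumE -row_sum_delta.
by apply: differentiable_sum => j; exact: differentiableZl.
Qed.

Lemma derive_entry {n} {F : V -> 'rV[R]_n} {u} v j :
  differentiable F u -> 'D_v (fun w => F w 0 j) u = ('D_v F u) 0 j.
Proof. by move=> /diff_derivable dF; rewrite (derive_mx (dF v)) mxE. Qed.

Lemma differentiableZr n (k : V -> R) (F : V -> 'rV[R]_n) u :
  differentiable k u -> differentiable F u ->
  differentiable (fun v => k v *: F v) u.
Proof.
move=> dk dF; apply: differentiable_row => j.
have -> : (fun v => (k v *: F v) 0 j) = k * (fun v => F v 0 j).
  by apply/funext => v; rewrite mxE.
exact/differentiableM/differentiable_entry.
Qed.

Lemma deriveZr n (k : V -> R) (F : V -> 'rV[R]_n) u v :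
  differentiable k u -> differentiable F u ->
  'D_v (fun w => k w *: F w) u = 'D_v k u *: F u + k u *: 'D_v F u.
Proof.
move=> dk dF; apply/rowP => j; rewrite -derive_entry; last first.
  exact: differentiableZr.
have -> : (fun v => (k v *: F v) 0 j) = k * (fun v => F v 0 j).
  by apply/funext => w; rewrite mxE.
rewrite deriveM; [|exact: diff_derivable|].
  by rewrite !mxE derive_entry// addrC /GRing.scale /= [F u 0 j * _]mulrC.
exact/diff_derivable/differentiable_entry.
Qed.

Lemma dotE (v w : 'rV[R]_4) : dot v w = \sum_j v 0 j * w 0 j.
Proof. by rewrite /dot mxE; apply: eq_bigr => j _; rewrite mxE. Qed.

Lemma differentiable_dot (F G : V -> 'rV[R]_4) u :
  differentiable F u -> differentiable G u ->
  differentiable (fun w => dot (F w) (G w)) u.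
Proof.
move=> dF dG.
have -> : (fun w => dot (F w) (G w)) =
    \sum_(j < 4) ((fun w => F w 0 j) * (fun w => G w 0 j)).
  by apply/funext => w; rewrite dotE fct_sumE.
by apply: differentiable_sum => j; apply: differentiableM;
  exact: differentiable_entry.
Qed.

Lemma derive_dot (F G : V -> 'rV[R]_4) u v :
  differentiable F u -> differentiable G u ->
  'D_v (fun w => dot (F w) (G w)) u = dot ('D_v F u) (G u) + dot (F u) ('D_v G u).
Proof.
move=> dF dG.
have -> : (fun w => dot (F w) (G w)) =
    \sum_(j < 4) ((fun w => F w 0 j) * (fun w => G w 0 j)).
  by apply/funext => w; rewrite dotE fct_sumE.
have dFj j := @diff_derivable _ _ _ _ _ v (differentiable_entry j dF).
have dGj j := @diff_derivable _ _ _ _ _ v (differentiable_entry j dG).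
rewrite derive_sum; last by move=> j; exact: derivableM.
rewrite !dotE -big_split /=; apply: eq_bigr => j _.
rewrite deriveM// !derive_entry// addrC /GRing.scale /=.
by rewrite [G u 0 j * _]mulrC.
Qed.

(** Near [u] both maps have the same first-order expansion, and uniqueness of the differential
    identifies ['d G u] with ['d F u]. This transfers differentiability along identities that are
    known only on an open set. *)
Lemma near_eq_differentiable {W : normedModType R} {F G : V -> W} {u} :
  (\forall y \near u, F y = G y) -> differentiable F u -> differentiable G u.
Proof.
move=> FG dF; have FGu := nbhs_singleton FG.
have dc := diff_continuous dF.
have GE : G \o shift u = cst (G u) + 'd F u +o_ (nbhs 0) id.
  have /diff_locally/eqaddoP E := dF.
  apply/eqaddoP => e e0; have {}E := E e e0.
  move: FG; rewrite (near_shift 0) => FG.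
  apply: filterS2 FG E => h /=.
  by rewrite !fctE /= subr0 FGu => ->.
by apply/diff_locallyP; rewrite (diff_unique dc GE).
Qed.
End RowCalculus.

(** * Smooth maps on an open set and derivatives along vector fields *)

Section SmoothMaps.
Context {R : realType} {U : set 'rV[R]_2}.
Hypothesis openU : open U.

Lemma smooth_differentiable {W : normedModType R} {F : 'rV[R]_2 -> W} {u} :
  smooth_on U F -> U u -> differentiable F u.
Proof. by move=> smF; exact: (smF [::]). Qed.

Lemma smooth_derive {W : normedModType R} {F : 'rV[R]_2 -> W} a :
  smooth_on U F -> smooth_on U ('D_a F).
Proof.
move=> smF vs u Uu; have := smF (rcons vs a) u Uu.
by rewrite /iterD foldr_rcons.
Qed.

Lemma near_open {u} : U u -> \forall v \near u, U v.
Proof. by move=> Uu; apply: open_nbhs_nbhs; split. Qed.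

Lemma derive_on {W : normedModType R} {F G : 'rV[R]_2 -> W} {u} v :
  U u -> (forall w, U w -> F w = G w) -> 'D_v F u = 'D_v G u.
Proof.
move=> Uu FG; apply: near_eq_derive.
by apply: filterS (near_open Uu) => w /FG.
Qed.

Lemma derive_commr {n} {F : 'rV[R]_2 -> 'rV[R]_n} {u} (a b : 'rV[R]_2) :
  smooth_on U F -> U u -> 'D_a ('D_b F) u = 'D_b ('D_a F) u.
Proof.
move=> smF Uu; apply/rowP => j.
have E (c w : 'rV[R]_2) : U w -> 'D_c (fun v => F v 0 j) w = ('D_c F) w 0 j.
  by move=> Uw; exact/derive_entry/(smooth_differentiable smF).
have dD (c : 'rV[R]_2) : differentiable ('D_c F) u.
  exact: smooth_differentiable (smooth_derive c smF) Uu.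
have dDj (c : 'rV[R]_2) : differentiable ('D_c (fun v => F v 0 j)) u.
  apply: (@near_eq_differentiable R _ _ (fun v => ('D_c F) v 0 j)).
    by apply: filterS (near_open Uu) => w /(E c).
  exact/differentiable_entry/dD.
have E2 (c d : 'rV[R]_2) : ('D_c ('D_d F) u) 0 j = 'D_c ('D_d (fun v => F v 0 j)) u.
  rewrite (derive_on _ Uu (E d)); apply/esym; exact: derive_entry.
apply: (etrans (E2 a b)); apply: (etrans _ (esym (E2 b a))).
apply: derive_comm => //.
apply: filterS (near_open Uu) => w Uw.
exact/differentiable_entry/(smooth_differentiable smF).
Qed.

Lemma row2_sum_delta (a : 'rV[R]_2) :
  a = a 0 0 *: delta_mx 0 0 + a 0 1 *: delta_mx 0 1.
Proof.
rewrite [LHS]row_sum_delta big_ord_recl big_ord1.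
by have -> : lift ord0 ord0 = 1 :> 'I_2 by exact/val_inj.
Qed.

Lemma derive_linear {n} {F : 'rV[R]_2 -> 'rV[R]_n} {u} a :
  smooth_on U F -> U u ->
  'D_a F u = a 0 0 *: 'D_(delta_mx 0 0) F u + a 0 1 *: 'D_(delta_mx 0 1) F u.
Proof.
move=> smF Uu; have dF := smooth_differentiable smF Uu.
rewrite !deriveEjacobian// [in LHS](row2_sum_delta a).
by rewrite mulmxDl -!scalemxAl.
Qed.

(** In coordinate derivatives ['D_(X w) F w] is a sum of products; after the product rule, the
    second-order terms recombine by symmetry of second derivatives. *)
Lemma derive_field {n} {F : 'rV[R]_2 -> 'rV[R]_n} {X : 'rV[R]_2 -> 'rV[R]_2} {u} :
  smooth_on U F -> smooth_on U X -> U u ->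
  differentiable (fun w => 'D_(X w) F w) u /\
  forall v, 'D_v (fun w => 'D_(X w) F w) u =
    'D_('D_v X u) F u + 'D_(X u) ('D_v F) u.
Proof.
move=> smF smX Uu.
have dX := smooth_differentiable smX Uu.
have dF a := smooth_differentiable (smooth_derive a smF) Uu.
pose G w := X w 0 0 *: 'D_(delta_mx 0 0) F w + X w 0 1 *: 'D_(delta_mx 0 1) F w.
have E w : U w -> 'D_(X w) F w = G w by exact: derive_linear.
have d0 j : differentiable (fun w => X w 0 j *: 'D_(delta_mx 0 j) F w) u.
  by apply: differentiableZr => //; exact: differentiable_entry.
have dG : differentiable G u by exact: differentiableD.
split; first by apply: near_eq_differentiable dG;
  apply: filterS (near_open Uu) => w /E.
move=> v; rewrite (derive_on v Uu E) deriveD; try exact: diff_derivable.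
have Ej j : 'D_v (fun w => X w 0 j *: 'D_(delta_mx 0 j) F w) u =
    ('D_v X u) 0 j *: 'D_(delta_mx 0 j) F u +
    X u 0 j *: 'D_(delta_mx 0 j) ('D_v F) u.
  have A := deriveZr _ _ _ _ v (differentiable_entry j dX) (dF (delta_mx 0 j)).
  have B : 'D_v (fun w => X w 0 j) u = ('D_v X u) 0 j by exact: derive_entry.
  have C := derive_commr v (delta_mx 0 j) smF Uu.
  exact: etrans A (congr2 (fun s w => s *: _ + _ *: w) B C).
apply: (etrans (congr2 +%R (Ej 0) (Ej 1))).
apply: etrans (congr2 +%R (esym (derive_linear ('D_v X u) smF Uu))
  (esym (derive_linear (X u) (smooth_derive v smF) Uu))).
exact: addrACA.
Qed.

(** The second-order terms given by [derive_field] cancel by symmetry; the first-order ones form the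
    bracket. *)
Lemma derive_bracket {n} {F : 'rV[R]_2 -> 'rV[R]_n} {X Y : 'rV[R]_2 -> 'rV[R]_2} {u} :
  smooth_on U F -> smooth_on U X -> smooth_on U Y -> U u ->
  'D_(X u) (fun w => 'D_(Y w) F w) u - 'D_(Y u) (fun w => 'D_(X w) F w) u =
  'D_(lie_bracket X Y u) F u.
Proof.
move=> smF smX smY Uu.
have [_ ->] := derive_field smF smX Uu; have [_ ->] := derive_field smF smY Uu.
have cancel (p q r s t : 'rV[R]_n) : q = s -> p - r = t -> p + q - (r + s) = t.
  by move=> -> <-; rewrite opprD addrACA subrr addr0.
apply: cancel; first exact: derive_commr.
have dF v := deriveEjacobian v (smooth_differentiable smF Uu).
apply: (etrans (congr2 (fun p q => p - q) (dF _) (dF _))).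
by apply: etrans _ (esym (dF _)); rewrite mulmxBl.
Qed.

End SmoothMaps.

(** * The standard inner product *)

Section Dot.
Context {R : realType}.
Implicit Types (v w z : 'rV[R]_4) (k : R).

Lemma dotC v w : dot v w = dot w v.
Proof. by rewrite !dotE; apply: eq_bigr => j _; rewrite mulrC. Qed.

Lemma dotDl v w z : dot (v + w) z = dot v z + dot w z.
Proof. by rewrite /dot mulmxDl mxE. Qed.

Lemma dotZl k v w : dot (k *: v) w = k * dot v w.
Proof. by rewrite /dot -scalemxAl mxE. Qed.

Lemma dotNl v w : dot (- v) w = - dot v w.
Proof. by rewrite /dot mulNmx mxE. Qed.

Lemma dotBl v w z : dot (v - w) z = dot v z - dot w z.
Proof. by rewrite dotDl dotNl. Qed.

Lemma dot0l v : dot 0 v = 0.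
Proof. by rewrite /dot mul0mx mxE. Qed.

Lemma dotDr v w z : dot z (v + w) = dot z v + dot z w.
Proof. by rewrite dotC dotDl !(dotC z). Qed.

Lemma dotZr k v w : dot w (k *: v) = k * dot w v.
Proof. by rewrite dotC dotZl (dotC w). Qed.

Lemma dotBr v w z : dot z (v - w) = dot z v - dot z w.
Proof. by rewrite dotC dotBl !(dotC z). Qed.

Lemma dot_eq0 v : dot v v = 0 -> v = 0.
Proof.
rewrite dotE => /eqP; rewrite psumr_eq0; last by move=> j _; rewrite -expr2 sqr_ge0.
move=> /allP v0; apply/rowP => j; rewrite mxE; apply/eqP.
by have := v0 j (mem_index_enum _); rewrite -expr2 sqrf_eq0.
Qed.

Lemma dot_mulmxl m (A : 'rV[R]_m) (B : 'M[R]_(m, 4)) v :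
  dot (A *m B) v = (A *m (v *m B^T)^T) 0 0.
Proof. by rewrite /dot trmx_mul trmxK mulmxA. Qed.

End Dot.

(** * Orthogonal splitting into tangential and normal parts *)

Section Projections.
Context {R : realType} {x : 'rV[R]_2 -> 'rV[R]_4} {u : 'rV[R]_2}.
Let J := 'J x u.
Hypothesis freeJ : row_free J.
Implicit Types w n : 'rV[R]_4.

Lemma tangent_spaceP w :
  reflect (exists a, w = a *m J) (w <= tangent_space x u)%MS.
Proof. by rewrite genmxE; apply: (iffP submxP) => -[a ->]; exists a. Qed.

Lemma normal_spaceP w :
  reflect (forall a, dot w (a *m J) = 0) (w <= normal_space x u)%MS.
Proof.
apply: (iffP sub_kermxP) => [w0 a|w0].
  by rewrite dotC dot_mulmxl w0 trmx0 mulmx0 mxE.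
apply/rowP => j; have := w0 (delta_mx 0 j).
by rewrite dotC dot_mulmxl -rowE !mxE.
Qed.

Lemma tangent_normal_disjoint w :
  (w <= tangent_space x u)%MS -> (w <= normal_space x u)%MS -> w = 0.
Proof.
by move=> /tangent_spaceP[a wa] /normal_spaceP/(_ a); rewrite -wa; exact: dot_eq0.
Qed.

Lemma tangent_normal_cap : (tangent_space x u :&: normal_space x u = 0)%MS.
Proof.
apply/eqP/rowV0P => w; rewrite sub_capmx => /andP[]; exact: tangent_normal_disjoint.
Qed.

Lemma rank_tangent_space : \rank (tangent_space x u) = 2.
Proof. by rewrite genmxE; exact/eqP. Qed.

Lemma rank_normal_space : \rank (normal_space x u) = 2.
Proof. by rewrite mxrank_ker mxrank_tr (eqP freeJ). Qed.

Lemma tan_nor_part w : tan_part x u w + nor_part x u w = w.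
Proof.
apply: add_proj_mx tangent_normal_cap _; apply: submx_full.
apply/eqP; rewrite mxrank_disjoint_sum ?tangent_normal_cap//.
by rewrite rank_tangent_space rank_normal_space.
Qed.

Lemma tan_part_sub w : (tan_part x u w <= tangent_space x u)%MS.
Proof. exact: proj_mx_sub. Qed.

Lemma nor_part_sub w : (nor_part x u w <= normal_space x u)%MS.
Proof. exact: proj_mx_sub. Qed.

Lemma dot_nor_part w a : dot (nor_part x u w) (a *m J) = 0.
Proof. exact/normal_spaceP/nor_part_sub. Qed.

Lemma dot_tan_part w a : dot (tan_part x u w) (a *m J) = dot w (a *m J).
Proof. by rewrite -[in RHS](tan_nor_part w) dotDl dot_nor_part addr0. Qed.

Lemma dot_nor_part_normal w n :
  (n <= normal_space x u)%MS -> dot n (nor_part x u w) = dot n w.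
Proof.
move=> /normal_spaceP n0; have /tangent_spaceP[a ta] := tan_part_sub w.
by rewrite -[in RHS](tan_nor_part w) dotDr ta n0 add0r.
Qed.

(** The difference of the two sides is both tangent and normal, hence zero. *)
Lemma eq_tan_part w t : (t <= tangent_space x u)%MS ->
  (forall a, dot w (a *m J) = dot t (a *m J)) -> tan_part x u w = t.
Proof.
move=> tt wt; apply/subr0_eq/tangent_normal_disjoint.
  by rewrite addmx_sub// ?eqmx_opp// tan_part_sub.
by apply/normal_spaceP => a; rewrite dotBl dot_tan_part wt subrr.
Qed.

End Projections.

(** * Differentiability of the tangential projection *)

Definition gram_det {R : realType} (p q : 'rV[R]_4) : R :=
  dot p p * dot q q - dot p q ^+ 2.

(* Cramer's rule for the Gram matrix of the frame (p, q). *)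
Definition proj_frame {R : realType} (p q w : 'rV[R]_4) : 'rV[R]_4 :=
  ((dot w p * dot q q - dot w q * dot p q) / gram_det p q) *: p +
  ((dot w q * dot p p - dot w p * dot p q) / gram_det p q) *: q.

Section Frame.
Context {R : realType}.
Implicit Types (p q w : 'rV[R]_4).

Lemma row2_mulmx (a : 'rV[R]_2) (J : 'M[R]_(2, 4)) :
  a *m J = a 0 0 *: (delta_mx 0 0 *m J) + a 0 1 *: (delta_mx 0 1 *m J).
Proof. by rewrite {1}(row2_sum_delta a) mulmxDl -!scalemxAl. Qed.

Lemma gram_det_neq0 (J : 'M[R]_(2, 4)) : row_free J ->
  gram_det (delta_mx 0 0 *m J) (delta_mx 0 1 *m J) != 0.
Proof.
move=> freeJ; apply/eqP; set p := _ *m J; set q := _ *m J => D0.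
have inj (a : 'rV[R]_2) : a *m J = 0 -> a = 0.
  by move=> aJ; apply: (row_free_inj freeJ); rewrite aJ mul0mx.
have q0 : dot q q = 0.
  (* The squared length of [dot q q *: p - dot p q *: q] is [dot q q * gram_det p q], which is zero
     here. *)
  have : (dot q q *: delta_mx 0 0 - dot p q *: delta_mx 0 1 : 'rV[R]_2) *m J = 0.
    rewrite mulmxBl -!scalemxAl -/p -/q; apply: dot_eq0.
    rewrite !(dotBl, dotBr, dotZl, dotZr) (dotC q p).
    by rewrite -[RHS](mulr0 (dot q q)) -D0 /gram_det; ring.
  move=> /inj H; have := congr1 (fun v : 'rV[R]_2 => v 0 0) H.
  by rewrite !mxE /= mulr1 mulr0 subr0.
have := congr1 (fun v : 'rV[R]_2 => v 0 1) (inj _ (dot_eq0 _ q0)); rewrite !mxE /=.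
by apply/eqP; rewrite oner_eq0.
Qed.

(** Differentiability in [u] cannot be read off [proj_mx]; Cramer's formula is rational in the frame
    and makes it visible. *)
Lemma tan_part_frame {x : 'rV[R]_2 -> 'rV[R]_4} {u} w : row_free ('J x u) ->
  tan_part x u w =
  proj_frame (delta_mx 0 0 *m 'J x u) (delta_mx 0 1 *m 'J x u) w.
Proof.
move=> freeJ; have := gram_det_neq0 _ freeJ.
set J := 'J x u; set p := _ *m J; set q := _ *m J => D0.
apply: eq_tan_part => //.
  by rewrite addmx_sub// scalemx_sub//; apply/tangent_spaceP; eexists.
move=> a; rewrite row2_mulmx -/p -/q.
rewrite !(dotDl, dotDr, dotZl, dotZr) (dotC q p).
by move: D0; rewrite /gram_det => D0; field.
Qed.

Lemma differentiable_proj_frame (V : normedModType R) (p q w : V -> 'rV[R]_4) u :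
  differentiable p u -> differentiable q u -> differentiable w u ->
  gram_det (p u) (q u) != 0 ->
  differentiable (fun v => proj_frame (p v) (q v) (w v)) u.
Proof.
move=> dp dq dw D0.
have dpp := differentiable_dot _ _ _ dp dp.
have dqq := differentiable_dot _ _ _ dq dq.
have dpq := differentiable_dot _ _ _ dp dq.
have dwp := differentiable_dot _ _ _ dw dp.
have dwq := differentiable_dot _ _ _ dw dq.
have dD : differentiable (fun v => (gram_det (p v) (q v))^-1) u.
  apply: differentiableV => //; apply: differentiableB.
    exact: differentiableM.
  exact: (differentiableM dpq dpq).
by apply: differentiableD; apply: differentiableZr => //;
  apply: differentiableM => //; apply: differentiableB; exact: differentiableM.
Qed.

End Frame.

(** * The Gauss equation *)

Section Gauss.
Context {R : realType} {U : set 'rV[R]_2} {x : 'rV[R]_2 -> 'rV[R]_4}.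
Hypotheses (openU : open U) (smx : smooth_on U x).
Hypothesis freeJ : forall u, U u -> row_free ('J x u).

Lemma derive_jacobian {u} a : U u -> 'D_a x u = a *m 'J x u.
Proof. move=> Uu; exact/deriveEjacobian/(smooth_differentiable smx). Qed.

Lemma differentiable_tan_part (w : 'rV[R]_2 -> 'rV[R]_4) u : U u ->
  differentiable w u -> differentiable (fun v => tan_part x v (w v)) u.
Proof.
move=> Uu dw.
have dD a := smooth_differentiable (smooth_derive a smx) Uu.
apply: (@near_eq_differentiable _ _ _ (fun v =>
    proj_frame ('D_(delta_mx 0 0) x v) ('D_(delta_mx 0 1) x v) (w v))).
  apply: filterS (near_open openU Uu) => v Uv /=.
  by rewrite tan_part_frame ?freeJ// !derive_jacobian.
apply: differentiable_proj_frame => //.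
by rewrite !derive_jacobian//; exact/gram_det_neq0/freeJ.
Qed.

(* Differentiate the identity [nabla_Y Z . W = D_Y Z . W] for [W := D_a x]. *)
Lemma dot_nabla2 X Y Z u a : smooth_on U Y -> smooth_on U Z -> U u ->
  dot (nabla x X (nabla x Y Z) u) ('D_a x u) =
  dot ('D_(X u) (fun v => 'D_(Y v) Z v) u) ('D_a x u) +
  dot (nor_part x u ('D_(Y u) Z u)) ('D_(X u) ('D_a x) u).
Proof.
move=> smY smZ Uu.
set V := fun v => 'D_(Y v) Z v; set W := 'D_a x; set T := nabla x Y Z.
have dV : differentiable V u := proj1 (derive_field openU smZ smY Uu).
have dT : differentiable T u by exact: differentiable_tan_part.
have dW : differentiable W u := smooth_differentiable (smooth_derive a smx) Uu.
have tanW v z : U v -> dot (tan_part x v z) (W v) = dot z (W v).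
  by move=> Uv; rewrite /W derive_jacobian// dot_tan_part// freeJ.
have TV v : U v -> dot (T v) (W v) = dot (V v) (W v) by exact: tanW.
have := derive_on openU (X u) Uu TV.
rewrite derive_dot// derive_dot// => E.
apply: etrans (tanW u _ Uu) _.
have split := tan_nor_part (freeJ _ Uu) (V u).
have -> : nor_part x u (V u) = V u - T u by rewrite -[V u in RHS]split addrC addKr.
by rewrite dotBl addrA -E addrK.
Qed.

(** In [dot_nabla2] for [(X, Y)] and for [(Y, X)], the terms with two derivatives of [Z] cancel
    against the bracket term by [derive_bracket]; the normal parts remain. *)
Lemma gauss X Y Z u a :
  smooth_on U X -> smooth_on U Y -> smooth_on U Z -> U u ->
  dot (curvature x X Y Z u) ('D_a x u) =
  dot (nor_part x u ('D_(Y u) Z u)) ('D_(X u) ('D_a x) u) -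
  dot (nor_part x u ('D_(X u) Z u)) ('D_(Y u) ('D_a x) u).
Proof.
move=> smX smY smZ Uu.
have comb (n1 n2 n3 A1 A2 A3 W : 'rV[R]_4) (q r : R) : A1 - A2 = A3 ->
    dot n1 W = dot A1 W + q -> dot n2 W = dot A2 W + r ->
    dot n3 W = dot A3 W -> dot (n1 - n2 - n3) W = q - r.
  by move=> <- E1 E2; rewrite !dotBl E1 E2 => ->; ring.
apply: comb (derive_bracket openU smZ smX smY Uu) (dot_nabla2 _ _ _ _ _ smY smZ Uu)
  (dot_nabla2 _ _ _ _ _ smX smZ Uu) _.
have E := derive_jacobian a Uu.
apply: etrans (congr1 _ E) _; apply: etrans _ (congr1 _ (esym E)).
exact/dot_tan_part/freeJ.
Qed.

End Gauss.

(** * Vanishing of the curvature and commuting shape operators *)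

Lemma span2P {K : fieldType} {n} {N : 'M[K]_n} {c z w : 'rV[K]_n} :
  (\rank N <= 2)%N -> c != 0 ->
  (c <= N)%MS -> (z <= N)%MS -> (w <= N)%MS ->
  (exists k, z = k *: c) \/ (exists k l, w = k *: c + l *: z).
Proof.
move=> rN c0 cN zN wN; case: (boolP (z <= c)%MS) => [/sub_rVP|zc]; first by left.
right; have czN : (c + z <= N)%MS by rewrite addsmx_sub cN.
have r2 : (\rank c < \rank (c + z)%MS)%N.
  have : (c < c + z)%MS by rewrite ltmxE addsmxSl addsmx_sub submx_refl.
  by rewrite ltmxErank => /andP[].
rewrite rank_rV c0 in r2.
have Ncz : (N <= c + z)%MS.
  by rewrite -(geq_leqif (mxrank_leqif_sup czN)) (leq_trans rN).
have /sub_addsmxP[[k l] ->] /= := submx_trans wN Ncz; exists (k 0 0), (l 0 0).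
by rewrite {1}[k]mx11_scalar {1}[l]mx11_scalar !mul_scalar_mx.
Qed.

Section Curvature.
Context {R : realType} {U : set 'rV[R]_2} {x : 'rV[R]_2 -> 'rV[R]_4}.
Hypothesis smx : smooth_on U x.

Lemma curvature_tangent X Y Z u : U u ->
  (curvature x X Y Z u <= tangent_space x u)%MS.
Proof.
move=> Uu; have T w : (tan_part x u w <= tangent_space x u)%MS by exact: tan_part_sub.
by rewrite /curvature /nabla !addmx_sub ?eqmx_opp.
Qed.

(** The curvature is a tangent vector, so the pairings with ['D_a x], which [gauss] computes,
    determine it. *)
Lemma curvature_eq0 X Y Z u : U u ->
  (forall a, dot (curvature x X Y Z u) ('D_a x u) = 0) -> curvature x X Y Z u = 0.
Proof.
move=> Uu R0; apply: (tangent_normal_disjoint _ (curvature_tangent X Y Z u Uu)).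
apply/normal_spaceP => a.
exact: etrans (congr1 _ (esym (derive_jacobian smx a Uu))) (R0 a).
Qed.

End Curvature.

Lemma smooth_cst (R : realType) (W : normedModType R) (U : set 'rV[R]_2) (k : W) :
  smooth_on U (cst k).
Proof.
move=> vs u _; have [k' ->] : exists k', iterD vs (cst k) = cst k'.
  elim: vs => [|v vs [k' IH]]; first by exists k.
  by exists 0; rewrite /= IH; apply/funext => w; rewrite derive_cst.
exact: differentiable_cst.
Qed.

(* [h] plays the role of the second fundamental form paired with normal vectors;
   the hypotheses on [t] and [s] say that they are the images of [-Y] and [-X]
   under the shape operator of [z] for the metric [h c].  The difference of the
   two sides is alternating in [(z, w)] and vanishes when [w = c]. *)
Lemma shape_operators_commute {R : realType} {N : 'M[R]_4} {c z w : 'rV[R]_4}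
    {h : 'rV[R]_4 -> 'rV[R]_2 -> 'rV[R]_2 -> R} {X Y t s : 'rV[R]_2} :
  (\rank N <= 2)%N -> c != 0 ->
  (c <= N)%MS -> (z <= N)%MS -> (w <= N)%MS ->
  (forall v a b, h v a b = h v b a) ->
  (forall k l v v' a b, h (k *: v + l *: v') a b = k * h v a b + l * h v' a b) ->
  (forall k v a b, h v (k *: a) b = k * h v a b) ->
  (forall a a', (forall b, h c a b = h c a' b) -> a = a') ->
  (forall b, h c t b = - h z Y b) -> (forall b, h c s b = - h z X b) ->
  h w X t = h w Y s.
Proof.
move=> rN c0 cN zN wN hC hD hZ hI ht hs.
case: (span2P rN c0 cN zN wN) => [[k zE]|[k [l ->]]].
  (* Here the shape operator of [z] is the scalar [k]. *)
  have hz a b : h z a b = k * h c a b.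
    by rewrite zE -[k *: c]addr0 -(scale0r c) hD mul0r addr0.
  have -> : t = - k *: Y by apply: hI => b; rewrite ht hz hZ mulNr.
  have -> : s = - k *: X by apply: hI => b; rewrite hs hz hZ mulNr.
  by rewrite !(hC w _ (- k *: _)) !hZ hC.
(* With [w = k *: c + l *: z], the [c] part of each side is [- h z X Y] and the [z] part is
   [- h c s t], by symmetry. *)
rewrite !hD (hC c X t) ht (hC c Y s) hs (hC z X t) (hC z Y s) (hC z Y X).
have -> : h z t X = - h c s t by rewrite hs opprK hC.
have -> : h z s Y = - h c t s by rewrite ht opprK hC.
by rewrite (hC c t).
Qed.

(** * Binary cubics and their pencils of quadratic forms *)

(** The conclusion is the vanishing of the determinant with rows [(g11, g12, g22)], [(A, B, C)],
    [(B, C, D)]. Cramer's rule expresses [G] times [n1, n2, m1, m2] in the coefficients, and the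
    last hypothesis, which will be the Gauss equation, is multiplied by [G]. *)
Lemma cubic_det {R : realFieldType} (g11 g12 g22 A B C D n1 n2 m1 m2 : R) :
  n1 * g11 + n2 * g12 = B -> n1 * g12 + n2 * g22 = C ->
  m1 * g11 + m2 * g12 = A -> m1 * g12 + m2 * g22 = B ->
  n1 * B + n2 * C = m1 * C + m2 * D ->
  g11 * (B * D - C ^+ 2) - g12 * (A * D - B * C) + g22 * (A * C - B ^+ 2) = 0.
Proof.
move=> EB EC EA EB' E; set G := g11 * g22 - g12 ^+ 2.
have e1 : B * g22 - C * g12 = n1 * G by rewrite -EB -EC /G; ring.
have e2 : C * g11 - B * g12 = n2 * G by rewrite -EB -EC /G; ring.
have e3 : A * g22 - B * g12 = m1 * G by rewrite -EA -EB' /G; ring.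
have e4 : B * g11 - A * g12 = m2 * G by rewrite -EA -EB' /G; ring.
have -> : g11 * (B * D - C ^+ 2) - g12 * (A * D - B * C) + g22 * (A * C - B ^+ 2) =
  (A * g22 - B * g12) * C + (B * g11 - A * g12) * D -
  ((B * g22 - C * g12) * B + (C * g11 - B * g12) * C) by ring.
rewrite e1 e2 e3 e4.
have -> : m1 * G * C + m2 * G * D - (n1 * G * B + n2 * G * C) =
  G * (m1 * C + m2 * D - (n1 * B + n2 * C)) by ring.
by rewrite E subrr mulr0.
Qed.

(* The determinant condition makes the quadratic forms with coefficients
   [(A, B, C)], [(B, C, D)] and [(g11, g12, g22)] linearly dependent; the last
   one being definite, the relation involves one of the first two. *)
Lemma cubic_pencil {R : realFieldType} (g11 g12 g22 A B C D : R) :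
  g11 != 0 -> g11 * g22 - g12 ^+ 2 != 0 ->
  g11 * (B * D - C ^+ 2) - g12 * (A * D - B * C) + g22 * (A * C - B ^+ 2) = 0 ->
  exists e1 e2 k, [/\ (e1 != 0) || (e2 != 0), e1 * A + e2 * B = k * g11,
    e1 * B + e2 * C = k * g12 & e1 * C + e2 * D = k * g22].
Proof.
move=> g0 G0 det0.
(* The witnesses are minors of the columns [(A, B, g11)] and [(B, C, g12)]; two equations are then
   identities and the third is the determinant condition. The next case does the same with the
   columns [(A, B, g11)] and [(C, D, g22)]. *)
case: (boolP ((g12 * B - g11 * C != 0) || (g11 * B - g12 * A != 0))) => [e0|].
  exists (g12 * B - g11 * C), (g11 * B - g12 * A), (B ^+ 2 - A * C).
  split=> //; [by ring|by ring|].
  by apply/subr0_eq; rewrite -det0; ring.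
rewrite negb_or !negbK !subr_eq0 => /andP[/eqP EC /eqP EB].
case: (boolP ((g22 * B - g11 * D != 0) || (g11 * C - g22 * A != 0))) => [e0|].
  exists (g22 * B - g11 * D), (g11 * C - g22 * A), (B * C - A * D).
  split=> //; [by ring| |by ring].
  by apply/subr0_eq; rewrite -[RHS]oppr0 -det0; ring.
rewrite negb_or !negbK !subr_eq0 => /andP[/eqP ED /eqP EC'].
(* With all these minors zero, [(g11 * g22 - g12 ^+ 2) * A = g11 * (g11 * C - g12 * B) = 0]; then
   [B], [C], [D] vanish as well and any pair [e1, e2] would do. *)
have A0 : A = 0.
  apply: (mulfI G0); rewrite mulr0 mulrBl -[g11 * _ * _]mulrA -EC' -EC.
  by rewrite mulrCA EB; ring.
have B0 : B = 0 by apply: (mulfI g0); rewrite EB A0 !mulr0.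
have C0 : C = 0 by apply: (mulfI g0); rewrite EC' A0 !mulr0.
have D0 : D = 0 by apply: (mulfI g0); rewrite -ED B0 !mulr0.
exists 1, 0, 0; rewrite oner_eq0 A0 B0 C0 D0.
by split=> //; ring.
Qed.

(** * Quadratic maps into a plane with values on a line *)

Section Plane.
Context {R : realType} {J : 'M[R]_(2, 4)}.
Hypothesis freeJ : row_free J.
Let x1 : 'rV[R]_4 := delta_mx 0 0 *m J.
Let x2 : 'rV[R]_4 := delta_mx 0 1 *m J.

Lemma mulmx_free_eq0 (a : 'rV[R]_2) : a *m J = 0 -> a = 0.
Proof. by move=> aJ; apply: (row_free_inj freeJ); rewrite aJ mul0mx. Qed.

Lemma dot_frame_eq0 (t : 'rV[R]_4) :
  (t <= J)%MS -> dot t x1 = 0 -> dot t x2 = 0 -> t = 0.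
Proof.
move=> /submxP[a ta] t1 t2; apply: dot_eq0; rewrite {2}ta row2_mulmx.
by rewrite dotDr !dotZr t1 t2 !mulr0 addr0.
Qed.

Lemma orthogonal_in_plane (t : 'rV[R]_4) : (t <= J)%MS -> t != 0 ->
  exists2 e : 'rV[R]_2, e != 0 & dot (e *m J) t = 0.
Proof.
move=> tJ t0.
(* The pair [(dot t x1, dot t x2)] turned by a right angle. *)
exists (- dot t x2 *: delta_mx 0 0 + dot t x1 *: delta_mx 0 1 : 'rV[R]_2).
  apply: contra_neq t0 => /rowP e0; apply: dot_frame_eq0 => //.
    by have := e0 1; rewrite !mxE /= mulr0 mulr1 add0r.
  by have := e0 0; rewrite !mxE /= mulr0 mulr1 addr0 => /eqP; rewrite oppr_eq0 => /eqP.
rewrite mulmxDl -!scalemxAl dotDl !dotZl -/x1 -/x2 !(dotC _ t).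
by rewrite mulNr mulrC addNr.
Qed.

Lemma orthogonal_decomposition (t d z : 'rV[R]_4) :
  (t <= J)%MS -> (d <= J)%MS -> (z <= J)%MS -> t != 0 -> d != 0 -> dot d t = 0 ->
  exists l, z = (dot z t / dot t t) *: t + l *: d.
Proof.
move=> tJ dJ zJ t0 d0 dt.
have tt : dot t t != 0 by apply: contra_neq t0; exact: dot_eq0.
case: (@span2P _ _ <<J>>%MS t d z); rewrite ?genmxE ?rank_leq_row//.
  move=> [k dE]; move: dt; rewrite dE dotZl => /eqP; rewrite mulf_eq0 (negPf tt).
  by rewrite orbF => /eqP k0; move: d0; rewrite dE k0 scale0r eqxx.
move=> [k [l ->]]; exists l.
by rewrite dotDl !dotZl dt mulr0 addr0 mulfK.
Qed.

Variables (A B C D : R) (v : 'rV[R]_2 -> 'rV[R]_4).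
Hypothesis vJ : forall a, (v a <= J)%MS.
Hypothesis v1 : forall a, dot (v a) x1 =
  - (a 0 0 ^+ 2 * A + 2 * a 0 0 * a 0 1 * B + a 0 1 ^+ 2 * C).
Hypothesis v2 : forall a, dot (v a) x2 =
  - (a 0 0 ^+ 2 * B + 2 * a 0 0 * a 0 1 * C + a 0 1 ^+ 2 * D).

Lemma dot_cubic e a : dot (v a) (e *m J) =
  - (a 0 0 ^+ 2 * (e 0 0 * A + e 0 1 * B) +
     2 * a 0 0 * a 0 1 * (e 0 0 * B + e 0 1 * C) +
     a 0 1 ^+ 2 * (e 0 0 * C + e 0 1 * D)).
Proof. by rewrite row2_mulmx dotDr !dotZr v1 v2; ring. Qed.

(** For the evolute, [J] spans the normal plane, [K] is the Jacobian and [v] the second fundamental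
    form. A relation from [cubic_pencil] yields [t = e *m J] with [dot (v a) t = - k * |a *m K|^2],
    so the normalized values have a constant component along [t]. *)
Lemma quadric_in_line (K : 'M[R]_(2, 4)) : row_free K ->
  let g11 := dot (delta_mx 0 0 *m K) (delta_mx 0 0 *m K) in
  let g12 := dot (delta_mx 0 0 *m K) (delta_mx 0 1 *m K) in
  let g22 := dot (delta_mx 0 1 *m K) (delta_mx 0 1 *m K) in
  g11 * (B * D - C ^+ 2) - g12 * (A * D - B * C) + g22 * (A * C - B ^+ 2) = 0 ->
  exists q d, [/\ (q <= J)%MS, (d <= J)%MS, d != 0 & forall a, a != 0 ->
    exists s, q + s *: d = (dot (a *m K) (a *m K))^-1 *: v a].
Proof.
move=> freeK g11 g12 g22 det0.
have kK (a : 'rV[R]_2) : a != 0 -> dot (a *m K) (a *m K) != 0.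
  apply: contra_neq => /dot_eq0 aK.
  by apply: (row_free_inj freeK); rewrite aK mul0mx.
have g0 : g11 != 0.
  apply: kK; apply/eqP => /rowP/(_ 0); rewrite !mxE /= => /eqP.
  by rewrite oner_eq0.
have [e1 [e2 [k [e0 E1 E2 E3]]]] :=
  cubic_pencil _ _ _ _ _ _ _ g0 (gram_det_neq0 _ freeK) det0.
pose e : 'rV[R]_2 := e1 *: delta_mx 0 0 + e2 *: delta_mx 0 1.
have e00 : e 0 0 = e1 by rewrite !mxE /= mulr0 mulr1 addr0.
have e01 : e 0 1 = e2 by rewrite !mxE /= mulr0 mulr1 add0r.
pose t := e *m J.
have tJ : (t <= J)%MS by exact: submxMl.
have t0 : t != 0.
  apply: contraTneq e0 => /mulmx_free_eq0 ee0.
  by rewrite -e00 -e01 ee0 !mxE eqxx.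
have [d' d'0 dt] := orthogonal_in_plane _ tJ t0.
have d0 : d' *m J != 0 by apply: contra_neq d'0; exact: mulmx_free_eq0.
exists ((- k / dot t t) *: t), (d' *m J); split=> //.
- exact: scalemx_sub.
- exact: submxMl.
move=> a a0; set G := dot (a *m K) (a *m K); have G0 : G != 0 := kK a a0.
have vt : dot (v a) t = - (k * G).
  rewrite dot_cubic e00 e01 E1 E2 E3 /G (row2_mulmx a K).
  rewrite !(dotDl, dotDr, dotZl, dotZr) (dotC (delta_mx 0 1 *m K)
    (delta_mx 0 0 *m K)).
  by rewrite -/g11 -/g12 -/g22; ring.
have [l zE] := orthogonal_decomposition _ _ (G^-1 *: v a) tJ (submxMl _ _)
  (scalemx_sub _ (vJ a)) t0 d0 dt.
exists l; rewrite [RHS]zE dotZl vt; congr (_ / _ *: _ + _).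
by rewrite mulrN mulrC mulfK.
Qed.

(** If [e *m J] is orthogonal to the line, the [e]-combinations of the cubic's coefficients vanish;
    the three equations write the Gram matrix of [J] through these coefficients, so [e *m J] is
    orthogonal to [x1] and [x2]. *)
Lemma quadric_not_in_line (c1 c2 : R) (K : 'M[R]_(2, 4)) : row_free K ->
  dot x1 x1 = c1 * A + c2 * B -> dot x1 x2 = c1 * B + c2 * C ->
  dot x2 x2 = c1 * C + c2 * D ->
  forall d, (d <= J)%MS -> d != 0 -> ~ (forall a, a != 0 ->
    exists s, 0 + s *: d = (dot (a *m K) (a *m K))^-1 *: v a).
Proof.
move=> freeK E11 E12 E22 d dJ d0 vd.
have [e e0 ed] := orthogonal_in_plane d dJ d0.
have v0 a : a != 0 -> dot (v a) (e *m J) = 0.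
  move=> a0; have [s /(congr1 (fun z => dot z (e *m J)))] := vd a a0.
  rewrite add0r !dotZl dotC ed mulr0 => /esym/eqP.
  rewrite mulf_eq0 invr_eq0 => /orP[/eqP/dot_eq0 aK|/eqP//].
  by move: a0; rewrite (row_free_inj freeK (etrans aK (esym (mul0mx _ _)))) eqxx.
(* The two basis vectors and their sum recover the three coefficients of the quadratic form. *)
have H11 := v0 (delta_mx 0 0); have H22 := v0 (delta_mx 0 1).
have H12 := v0 (delta_mx 0 0 + delta_mx 0 1).
move: H11 H12 H22; rewrite !dot_cubic !mxE /=.
have n1 : delta_mx 0 0 != 0 :> 'rV[R]_2.
  by apply/eqP => /rowP/(_ 0); rewrite !mxE /= => /eqP; rewrite oner_eq0.
have n2 : delta_mx 0 1 != 0 :> 'rV[R]_2.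
  by apply/eqP => /rowP/(_ 1); rewrite !mxE /= => /eqP; rewrite oner_eq0.
have n3 : delta_mx 0 0 + delta_mx 0 1 != 0 :> 'rV[R]_2.
  by apply/eqP => /rowP/(_ 0); rewrite !mxE /= addr0 => /eqP; rewrite oner_eq0.
move=> /(_ n1) H11 /(_ n3) H12 /(_ n2) H22.
have t0 : e *m J = 0.
  apply: dot_frame_eq0; first exact: submxMl.
    rewrite row2_mulmx dotDl !dotZl -/x1 -/x2 (dotC x2) E11 E12.
    have -> : e 0 0 * (c1 * A + c2 * B) + e 0 1 * (c1 * B + c2 * C) =
      c1 * (e 0 0 * A + e 0 1 * B) + c2 * (e 0 0 * B + e 0 1 * C) by ring.
    have -> : e 0 0 * A + e 0 1 * B = 0 by lra.
    have -> : e 0 0 * B + e 0 1 * C = 0 by lra.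
    by rewrite !mulr0 addr0.
  rewrite row2_mulmx dotDl !dotZl -/x1 -/x2 E22 E12.
  have -> : e 0 0 * (c1 * B + c2 * C) + e 0 1 * (c1 * C + c2 * D) =
    c1 * (e 0 0 * B + e 0 1 * C) + c2 * (e 0 0 * C + e 0 1 * D) by ring.
  have -> : e 0 0 * C + e 0 1 * D = 0 by lra.
  have -> : e 0 0 * B + e 0 1 * C = 0 by lra.
  by rewrite !mulr0 addr0.
by move: e0; rewrite (mulmx_free_eq0 _ t0) eqxx.
Qed.

End Plane.

(** Linearity in the first slot passes to the second by symmetry, and the symmetries leave four
    coefficients. *)
Lemma symmetric_trilinear_quadratic {R : comNzRingType}
    {T : 'rV[R]_2 -> 'rV[R]_2 -> 'rV[R]_2 -> R} :
  let e0 := delta_mx 0 0 in let e1 := delta_mx 0 1 in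
  (forall a b k, T a b k = T b a k) -> (forall a b k, T a b k = T a k b) ->
  (forall a b k, T a b k = a 0 0 * T e0 b k + a 0 1 * T e1 b k) ->
  forall a, T a a e0 = a 0 0 ^+ 2 * T e0 e0 e0 + 2 * a 0 0 * a 0 1 * T e0 e0 e1 +
              a 0 1 ^+ 2 * T e0 e1 e1 /\
            T a a e1 = a 0 0 ^+ 2 * T e0 e0 e1 + 2 * a 0 0 * a 0 1 * T e0 e1 e1 +
              a 0 1 ^+ 2 * T e1 e1 e1.
Proof.
move=> e0 e1 TC TA TL a.
have quad k : T a a k = a 0 0 ^+ 2 * T e0 e0 k + 2 * a 0 0 * a 0 1 * T e0 e1 k +
    a 0 1 ^+ 2 * T e1 e1 k.
  by rewrite TL (TC e0) (TC e1) (TL a e0) (TL a e1) (TC e1 e0); ring.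
by rewrite !quad (TA e0 e1 e0) (TA e1 e1 e0) (TC e1 e0 e1).
Qed.

(** * Geometry of the evolute in a chart *)

Section Evolute.
Context {R : realType} {U : set 'rV[R]_2} {x c : 'rV[R]_2 -> 'rV[R]_4}.
Let y u := x u + c u.
Hypotheses (openU : open U) (smx : smooth_on U x) (smc : smooth_on U c).
Hypothesis (smy : smooth_on U y).
Hypothesis freeJx : forall u, U u -> row_free ('J x u).
Hypothesis freeJy : forall u, U u -> row_free ('J y u).
Hypothesis normal_c : forall u, U u -> (c u <= normal_space x u)%MS.
Hypothesis c_alpha : forall u a b, U u ->
  dot (c u) (second_form x u a b) = first_form x u a b.

(** Weingarten's equation, from differentiating [Z . D_b x = 0]. *)
Lemma dot_derive_normal Z u a b : smooth_on U Z ->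
  (forall v, U v -> (Z v <= normal_space x v)%MS) -> U u ->
  dot ('D_a Z u) ('D_b x u) = - dot (Z u) ('D_a ('D_b x) u).
Proof.
move=> smZ nZ Uu; have E v : U v -> dot (Z v) ('D_b x v) = cst (0 : R) v.
  move=> Uv; apply: etrans (congr1 _ (derive_jacobian smx b Uv)) _.
  exact/normal_spaceP/nZ.
have := derive_on openU a Uu E.
rewrite derive_dot; [|exact: smooth_differentiable smZ Uu|].
  by rewrite derive_cst => /eqP; rewrite addr_eq0 => /eqP.
exact: smooth_differentiable (smooth_derive b smx) Uu.
Qed.

(** As [c] is normal, the projection in [second_form] does not change the pairing. *)
Lemma dot_c_hessian u a b : U u ->
  dot (c u) ('D_a ('D_b x) u) = dot ('D_a x u) ('D_b x u).
Proof.
move=> Uu; apply: etrans _ (c_alpha u a b Uu).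
exact/esym/(dot_nor_part_normal (freeJx _ Uu))/normal_c.
Qed.

Lemma derive_evolute_normal u a : U u -> ('D_a y u <= normal_space x u)%MS.
Proof.
move=> Uu; apply/normal_spaceP => b.
apply: etrans (congr1 _ (esym (derive_jacobian smx b Uu))) _.
have E : 'D_a y u = 'D_a x u + 'D_a c u.
  apply: deriveD; apply: diff_derivable.
    exact: smooth_differentiable smx Uu.
  exact: smooth_differentiable smc Uu.
have cancel (p q r w : 'rV[R]_4) : r = p + q -> dot q w = - dot p w -> dot r w = 0.
  by move=> -> qw; rewrite dotDl qw subrr.
apply: cancel E _; apply: etrans (dot_derive_normal _ _ _ _ smc normal_c Uu) _.
exact: congr1 _ (dot_c_hessian _ _ _ Uu).
Qed.

Lemma tangent_evolute u : U u -> (tangent_space y u :=: normal_space x u)%MS.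
Proof.
move=> Uu; apply/eqmxP; rewrite -(geq_leqif (mxrank_leqif_eq _)).
  by rewrite rank_normal_space ?rank_tangent_space ?freeJx ?freeJy.
apply/rV_subP => w /(tangent_spaceP)[a ->].
by rewrite -(derive_jacobian smy)// derive_evolute_normal.
Qed.

Lemma normal_evolute u : U u -> (normal_space y u :=: tangent_space x u)%MS.
Proof.
move=> Uu; apply/eqmx_sym/eqmxP; rewrite -(geq_leqif (mxrank_leqif_eq _)).
  by rewrite rank_normal_space ?rank_tangent_space ?freeJx ?freeJy.
apply/rV_subP => w /tangent_spaceP[a ->]; apply/normal_spaceP => b.
rewrite dotC -(derive_jacobian smy)//.
by apply/normal_spaceP/derive_evolute_normal.
Qed.

Lemma hessianC u v a b : U u ->
  dot v ('D_a ('D_b x) u) = dot v ('D_b ('D_a x) u).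
Proof. by move=> Uu; exact/congr1/(derive_commr openU). Qed.

Lemma hessianZ u v k a b : U u ->
  dot v ('D_(k *: a) ('D_b x) u) = k * dot v ('D_a ('D_b x) u).
Proof.
move=> Uu; have dD := smooth_differentiable (smooth_derive b smx) Uu.
apply: etrans _ (dotZr _ _ _); apply: congr1.
apply: etrans (deriveEjacobian _ dD) _; apply: etrans (esym (scalemxAl _ _ _)) _.
exact: congr1 _ (esym (deriveEjacobian _ dD)).
Qed.

Lemma derive_inj u a a' : U u ->
  (forall b, dot ('D_a x u) ('D_b x u) = dot ('D_a' x u) ('D_b x u)) -> a = a'.
Proof.
move=> Uu; have D := derive_jacobian smx _ Uu => H.
apply: (row_free_inj (freeJx _ Uu)); apply/subr0_eq.
rewrite -mulmxBl; apply: dot_eq0; rewrite {1}mulmxBl dotBl.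
by move: (H (a - a')); rewrite !D => ->; rewrite subrr.
Qed.

Lemma c_neq0 u : U u -> c u != 0.
Proof.
move=> Uu; apply/eqP => c0.
have : delta_mx 0 0 = 0 :> 'rV[R]_2.
  apply: (derive_inj u _ _ Uu) => b.
  apply: etrans (esym (dot_c_hessian _ _ _ Uu)) _.
  apply: etrans _ (dot_c_hessian _ _ _ Uu).
  have H v : dot (c u) v = 0 by rewrite c0 dot0l.
  exact: etrans (H _) (esym (H _)).
by move/rowP/(_ 0); rewrite !mxE /= => /eqP; rewrite oner_eq0.
Qed.

Lemma curvature_evolute X Y Z u :
  smooth_on U X -> smooth_on U Y -> smooth_on U Z ->
  (forall v, U v -> (Z v <= tangent_space y v)%MS) -> U u ->
  curvature y X Y Z u = 0.
Proof.
move=> smX smY smZ tZ Uu; apply: (curvature_eq0 smy _ _ _ _ Uu) => a.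
apply: etrans (gauss openU smy freeJy _ _ _ _ a smX smY smZ Uu) _.
have nZ v : U v -> (Z v <= normal_space x v)%MS.
  by move=> Uv; rewrite -tangent_evolute ?tZ.
have na v : U v -> ('D_a y v <= normal_space x v)%MS.
  exact: derive_evolute_normal.
(* Normal to the evolute means tangent to [x]: the normal part is ['D_t x], where [- t] is the image
   of [v] under the shape operator of [Z] on [x]. *)
have norP v : exists t, nor_part y u ('D_v Z u) = 'D_t x u /\
    forall b, dot (c u) ('D_t ('D_b x) u) = - dot (Z u) ('D_v ('D_b x) u).
  have : (nor_part y u ('D_v Z u) <= tangent_space x u)%MS.
    by rewrite -normal_evolute ?nor_part_sub.
  move=> /tangent_spaceP[t E0]; have E := etrans E0 (esym (derive_jacobian smx t Uu)).
  exists t; split=> // b.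
  apply: etrans (dot_c_hessian _ _ _ Uu) _.
  apply: etrans _ (dot_derive_normal _ _ _ _ smZ nZ Uu).
  have swap (p q r w : 'rV[R]_4) : p = q -> dot r p = dot r w -> dot q r = dot w r.
    by move=> <- H; rewrite dotC H dotC.
  apply: swap E _; apply: (dot_nor_part_normal (freeJy _ Uu)).
  rewrite normal_evolute//; apply/tangent_spaceP; exists b.
  exact (derive_jacobian smx b Uu).
have [t [tE ht]] := norP (Y u); have [s [sE hs]] := norP (X u).
have pair v r : dot ('D_r x u) ('D_v ('D_a y) u) = - dot ('D_a y u) ('D_v ('D_r x) u).
  apply: etrans (dotC _ _) _.
  exact: dot_derive_normal (smooth_derive a smy) na Uu.
apply: etrans (congr2 (fun v w => dot v _ - dot w _) tE sE) _.
apply: etrans (congr2 (fun v w => v - w) (pair _ _) (pair _ _)) _.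
apply/eqP; rewrite subr_eq0; apply/eqP; apply: congr1.
(* For this [h], the slice [h c] is the first fundamental form of [x], hence nondegenerate. *)
apply: (@shape_operators_commute _ (normal_space x u) (c u) (Z u) _
  (fun v a b => dot v ('D_a ('D_b x) u))).
- by rewrite rank_normal_space// freeJx.
- exact: c_neq0.
- exact: normal_c.
- exact: nZ.
- exact: na.
- by move=> v p q; exact: hessianC.
- by move=> k l v v' p q; rewrite dotDl !dotZl.
- by move=> k v p q; exact: hessianZ.
- move=> p q H; apply: (derive_inj u _ _ Uu) => b.
  exact: etrans (esym (dot_c_hessian _ _ _ Uu)) (etrans (H b) (dot_c_hessian _ _ _ Uu)).
- exact: ht.
- exact: hs.
Qed.

(* The components of minus the second fundamental form of the evolute along the
   vectors ['D_k x], which are normal to the evolute. *)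
Definition cubic u (a b k : 'rV[R]_2) := dot ('D_a y u) ('D_b ('D_k x) u).

Lemma cubic_second_derivative u a b k : U u ->
  dot ('D_b ('D_a y) u) ('D_k x u) = - cubic u a b k.
Proof.
move=> Uu; apply: (dot_derive_normal _ _ _ _ (smooth_derive a smy) _ Uu).
move=> v Uv; exact: (derive_evolute_normal).
Qed.

(** This symmetry comes from the second derivatives of [y], the one in the last two arguments from
    those of [x]. *)
Lemma cubicCA u a b k : U u -> cubic u a b k = cubic u b a k.
Proof.
move=> Uu; apply: oppr_inj.
apply: etrans (esym (cubic_second_derivative _ _ _ _ Uu)) _.
apply: etrans _ (cubic_second_derivative _ _ _ _ Uu).
exact (congr1 (fun v : 'rV[R]_4 => dot v _) (derive_commr openU b a smy Uu)).
Qed.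

Lemma cubicAC u a b k : U u -> cubic u a b k = cubic u a k b.
Proof. exact: (hessianC). Qed.

Lemma cubic_linear u a b k : U u -> cubic u a b k =
  a 0 0 * cubic u (delta_mx 0 0) b k + a 0 1 * cubic u (delta_mx 0 1) b k.
Proof.
move=> Uu; have comb (l m : R) (p q r w : 'rV[R]_4) :
    r = l *: p + m *: q -> dot r w = l * dot p w + m * dot q w.
  by move=> ->; rewrite dotDl !dotZl.
exact: comb (derive_linear a smy Uu).
Qed.

Let e0 : 'rV[R]_2 := delta_mx 0 0.
Let e1 : 'rV[R]_2 := delta_mx 0 1.

Lemma second_form_evolute u : U u -> let v a := second_form y u a a in
  [/\ forall a, (v a <= 'J x u)%MS,
  forall a, dot (v a) (e0 *m 'J x u) =
    - (a 0 0 ^+ 2 * cubic u e0 e0 e0 + 2 * a 0 0 * a 0 1 * cubic u e0 e0 e1 +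
       a 0 1 ^+ 2 * cubic u e0 e1 e1) &
  forall a, dot (v a) (e1 *m 'J x u) =
    - (a 0 0 ^+ 2 * cubic u e0 e0 e1 + 2 * a 0 0 * a 0 1 * cubic u e0 e1 e1 +
       a 0 1 ^+ 2 * cubic u e1 e1 e1)].
Proof.
move=> Uu v.
have nE := normal_evolute _ Uu.
have val a k : dot (v a) (k *m 'J x u) = - cubic u a a k.
  have E := derive_jacobian smx k Uu.
  apply: etrans (congr1 _ (esym E)) _.
  apply: etrans _ (cubic_second_derivative u a a k Uu).
  apply: etrans (dotC _ _) _; apply: etrans _ (dotC _ _).
  apply: (dot_nor_part_normal (freeJy _ Uu)).
  by rewrite nE; apply/tangent_spaceP; exists k; exact E.
have quad := symmetric_trilinear_quadratic (fun a b k => cubicCA u a b k Uu)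
  (fun a b k => cubicAC u a b k Uu) (fun a b k => cubic_linear u a b k Uu).
split=> a.
- have : (second_form y u a a <= normal_space y u)%MS by exact: nor_part_sub.
  by rewrite nE genmxE.
- exact: etrans (val a _) (congr1 _ (proj1 (quad a))).
- exact: etrans (val a _) (congr1 _ (proj2 (quad a))).
Qed.

Lemma first_form_jacobian u a : U u ->
  first_form y u a a = dot (a *m 'J y u) (a *m 'J y u).
Proof.
by move=> Uu; have E := derive_jacobian smy a Uu; rewrite /first_form E.
Qed.

(** A normal vector of [x] is tangent to [y]; its components [n] there turn pairings with second
    derivatives of [x] into contractions of [cubic]. *)
Lemma normal_cubic u v : U u -> (v <= normal_space x u)%MS ->
  exists n : 'rV[R]_2, v = n *m 'J y u /\
    forall b k, dot v ('D_b ('D_k x) u) = cubic u n b k.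
Proof.
move=> Uu; have tE := tangent_evolute _ Uu.
rewrite -tE => /tangent_spaceP[n vE]; exists n; split=> // b k.
have E := etrans vE (esym (derive_jacobian smy n Uu)).
exact (congr1 (fun v : 'rV[R]_4 => dot v _) E).
Qed.

(** The components of [c] in the frame of the evolute turn [c . alpha = g] into these equations. *)
Lemma c_cubic u : U u -> exists c1 c2, let J := 'J x u in
  [/\ dot (e0 *m J) (e0 *m J) = c1 * cubic u e0 e0 e0 + c2 * cubic u e0 e0 e1,
      dot (e0 *m J) (e1 *m J) = c1 * cubic u e0 e0 e1 + c2 * cubic u e0 e1 e1 &
      dot (e1 *m J) (e1 *m J) = c1 * cubic u e0 e1 e1 + c2 * cubic u e1 e1 e1].
Proof.
move=> Uu; have [n [_ cE]] := normal_cubic u _ Uu (normal_c _ Uu).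
have val b k : dot (b *m 'J x u) (k *m 'J x u) =
    n 0 0 * cubic u e0 b k + n 0 1 * cubic u e1 b k.
  have D a := derive_jacobian smx a Uu.
  apply: etrans (congr2 (fun v w : 'rV[R]_4 => dot v w) (esym (D b)) (esym (D k))) _.
  apply: etrans (esym (dot_c_hessian _ _ _ Uu)) _.
  exact: etrans (cE b k) (cubic_linear _ _ _ _ Uu).
have C100 : cubic u e1 e0 e0 = cubic u e0 e0 e1 :=
  etrans (cubicCA u e1 e0 e0 Uu) (cubicAC u e0 e1 e0 Uu).
have C101 := cubicCA u e1 e0 e1 Uu.
exists (n 0 0), (n 0 1); split.
- exact: etrans (val e0 e0) (congr1 (fun p => _ + _ * p) C100).
- exact: etrans (val e0 e1) (congr1 (fun p => _ + _ * p) C101).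
- exact: val e1 e1.
Qed.

(** The Gauss equation of the flat [x] reads [alpha(e0, e1) . alpha(e0, e1) = alpha(e0, e0) .
    alpha(e1, e1)]; it is rewritten in the frame of [y], which spans the normal plane of [x]. *)
Lemma flat_cubic u : U u ->
  curvature x (cst e0) (cst e1) ('D_e0 x) u = 0 ->
  let K := 'J y u in
  dot (e0 *m K) (e0 *m K) *
    (cubic u e0 e0 e1 * cubic u e1 e1 e1 - cubic u e0 e1 e1 ^+ 2) -
  dot (e0 *m K) (e1 *m K) *
    (cubic u e0 e0 e0 * cubic u e1 e1 e1 - cubic u e0 e0 e1 * cubic u e0 e1 e1) +
  dot (e1 *m K) (e1 *m K) *
    (cubic u e0 e0 e0 * cubic u e0 e1 e1 - cubic u e0 e0 e1 ^+ 2) = 0.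
Proof.
move=> Uu R0 K.
have norP b k : exists n : 'rV[R]_2,
    (forall b' k', dot (nor_part x u ('D_b ('D_k x) u)) ('D_b' ('D_k' x) u) =
      n 0 0 * cubic u e0 b' k' + n 0 1 * cubic u e1 b' k') /\
    forall a, n 0 0 * dot (e0 *m K) (a *m K) + n 0 1 * dot (e1 *m K) (a *m K) =
      cubic u a b k.
  set v := nor_part x u _.
  have nv : (v <= normal_space x u)%MS by exact: nor_part_sub.
  have [n [vE vC]] := normal_cubic u v Uu nv; exists n; split=> [b' k'|a].
    exact: etrans (vC b' k') (cubic_linear _ _ _ _ Uu).
  have na := derive_evolute_normal u a Uu.
  apply: etrans _ (dot_nor_part_normal (freeJx _ Uu) _ _ na).
  have E := derive_jacobian smy a Uu.
  apply: etrans _ (congr1 (fun w : 'rV[R]_4 => dot w _) (esym E)).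
  by rewrite -/v vE (row2_mulmx n) dotDr !dotZr !(dotC (a *m _)).
have gC : dot (e1 *m K) (e0 *m K) = dot (e0 *m K) (e1 *m K) := dotC _ _.
(* [n] and [m] are the components of [alpha(e1, e0)] and [alpha(e0, e0)] in that frame. *)
have [n [nC nE]] := norP e1 e0; have [m [mC mE]] := norP e0 e0.
have smc0 (a : 'rV[R]_2) : smooth_on U (cst a) := smooth_cst R _ U a.
have := gauss openU smx freeJx _ _ _ _ e1 (smc0 e0) (smc0 e1) (smooth_derive e0 smx) Uu.
move=> /(etrans (esym (etrans (congr1 (fun w : 'rV[R]_4 => dot w _) R0) (dot0l _)))).
move=> /(fun E => etrans E (congr2 (fun p q => p - q) (nC e0 e1) (mC e1 e1))).
move=> /esym/subr0_eq E.
have C101 := cubicCA u e1 e0 e1 Uu.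
have C010 := cubicAC u e0 e1 e0 Uu.
have C110 : cubic u e1 e1 e0 = cubic u e0 e1 e1 := etrans (cubicAC u e1 e1 e0 Uu) C101.
have C100 : cubic u e1 e0 e0 = cubic u e0 e0 e1 := etrans (cubicCA u e1 e0 e0 Uu) C010.
apply: (cubic_det _ _ _ _ _ _ _ (n 0 0) (n 0 1) (m 0 0) (m 0 1)).
- exact (etrans (congr1 (fun p => _ + _ * p) (esym gC)) (etrans (nE e0) C010)).
- exact (etrans (nE e1) C110).
- exact (etrans (congr1 (fun p => _ + _ * p) (esym gC)) (mE e0)).
- exact (etrans (mE e1) C100).
- exact (etrans (congr1 (fun p => _ + _ * p) (esym C101)) E).
Qed.

Lemma semiumbilic_evolute u : U u ->
  curvature x (cst e0) (cst e1) ('D_e0 x) u = 0 -> semiumbilic_at y u.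
Proof.
move=> Uu R0.
have [vJ v0 v1] := second_form_evolute u Uu.
have nE := normal_evolute _ Uu.
have [q [d [qJ dJ d0 line]]] := quadric_in_line (freeJx _ Uu) _ _ _ _ _
  vJ v0 v1 _ (freeJy _ Uu) (flat_cubic u Uu R0).
exists q, d; split=> //; try by rewrite nE genmxE.
move=> _ [a a0 <-]; have [s sE] := line a a0; exists s => //.
by rewrite first_form_jacobian.
Qed.

Lemma not_inflection_evolute u : U u -> ~ inflection_at y u.
Proof.
move=> Uu [d [dN d0 line]].
have [vJ v0 v1] := second_form_evolute u Uu.
have nE := normal_evolute _ Uu.
rewrite nE genmxE in dN.
have [c1 [c2 [E11 E12 E22]]] := c_cubic u Uu.
apply: (quadric_not_in_line (freeJx _ Uu) _ _ _ _ _ v0 v1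
  _ _ _ (freeJy _ Uu) E11 E12 E22 d dN d0) => a a0.
have [|s _ sE] := line ((first_form y u a a)^-1 *: second_form y u a a).
  by exists a.
by exists s; rewrite sE first_form_jacobian.
Qed.

End Evolute.

Theorem theorem4p5 (R : realType) (M : surface R) (phi c : M -> 'rV[R]_4)
    (phi_immersion : immersion phi) (phi_semiumbilical : semiumbilical phi)
    (c_section : normal_section phi c) (c_alpha : dual_to_second_form phi c)
    (f := fun p : M => phi p + c p) (f_immersion : immersion f) :
  flat f /\ (flat phi -> semiumbilical f).
Proof.
have dual i u a b := @c_alpha i u a b.
split=> [i X Y Z smX smY smZ tZ u Uu|flat_phi i u Uu].
  have [[smx freex] [smy freey] [smc normalc]] :=
    And3 (phi_immersion i) (f_immersion i) (c_section i).
  exact (curvature_evolute (@dom_open R M i) smx smc smy freex freey normalc (dual i)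
    _ _ _ _ smX smY smZ tZ Uu).
have [[smx freex] [smy freey] [smc normalc]] :=
  And3 (phi_immersion i) (f_immersion i) (c_section i).
split; last first.
  exact: (not_inflection_evolute (@dom_open R M i) smx smc smy freex freey
    normalc (dual i)).
apply: (semiumbilic_evolute (@dom_open R M i) smx smc smy freex freey normalc
  (dual i) _ Uu).
(* Flatness is applied to the coordinate fields, with [Z] the first of them as a map to the ambient
   space. *)
apply: flat_phi Uu; [exact: smooth_cst|exact: smooth_cst|exact: smooth_derive|].
move=> v Uv; apply/tangent_spaceP; exists (delta_mx 0 0).
exact (derive_jacobian smx _ Uv).
Qed.
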